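(* Consider a $K$-class classification problem with $n$ samples per class, $N=nK$, inputs $x_{k,i}\in\mathbb{R}^d$ ($k\in[K]$, $i\in[n]$) and one-hot labels $y_k=e_k\in\mathbb{R}^K$. Let $X\in\mathbb{R}^{d\times N}$ be the matrix of inputs and $Y\in\mathbb{R}^{K\times N}$ the corresponding label matrix, and suppose $X$ is square ($d=N$) and orthogonal. Consider an $L$-layer linear network with weights $W_l\in\mathbb{R}^{d\times d}$ for $l\in[L-1]$ and $W_L\in\mathbb{R}^{K\times d}$, with $d>2K$. Suppose there is $\varepsilon>0$ with $$\varepsilon\le\min\Big\{\frac{n^{1/(2L)}}{\sqrt{30}\,L\,(d-K)^{1/4}},\ \frac{(n/2)^{1/(4L)}}{(d-K)^{1/4}},\ \frac{1}{\sqrt{2(\sqrt K+1)}}\Big\}$$ such that: (i) (global optimality) $W_{L:1}X=Y$; (ii) (balancedness) $W_{l+1}^\top W_{l+1}=W_lW_l^\top$ for all $l\in[L-2]$, and $\|W_L^\top W_L-W_{L-1}W_{L-1}^\top\|_F\le\varepsilon^2\sqrt{d-K}$; (iii) (unchanged spectrum) there is an index set $\mathcal{A}\subseteq[d]$ with $|\mathcal{A}|=d-2K$ such that $\sigma_i(W_l)=\varepsilon$ for all $i\in\mathcal{A}$ and all $l\in[L-1]$. Then for all $l=0,1,\dots,L-2$, $$D_{l+1}/D_l\le 2(\sqrt K+1)\varepsilon^2.$$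
   Context: $W_{l:1}=W_l\cdots W_1$. Features: $z^l_{k,i}=W_{l:1}x_{k,i}$ for $l\ge1$ and $z^0_{k,i}=x_{k,i}$. Class means $\bar z^l_k=\frac1n\sum_{i=1}^n z^l_{k,i}$, global mean $\bar z^l=\frac1K\sum_{k=1}^K\bar z^l_k$. Within-class and between-class covariances $\Sigma_W^l=\frac1N\sum_{k=1}^K\sum_{i=1}^n(z^l_{k,i}-\bar z^l_k)(z^l_{k,i}-\bar z^l_k)^\top$, $\Sigma_B^l=\frac1K\sum_{k=1}^K(\bar z^l_k-\bar z^l)(\bar z^l_k-\bar z^l)^\top$, and separation measure $D_l=\mathrm{Tr}(\Sigma_W^l)/\mathrm{Tr}(\Sigma_B^l)$. $\sigma_i(A)$ is the $i$-th largest singular value. *)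

(* Defs.v *)
From HB Require Import structures.
From mathcomp Require Import all_boot all_order all_algebra.
From mathcomp Require Import boolp classical_sets reals exp.
Set Implicit Arguments. Unset Strict Implicit. Unset Printing Implicit Defensive.
Import Order.TTheory GRing.Theory Num.Theory.
Local Open Scope ring_scope.

Section Defs.
Variable R : realType.

Definition frob (m p : nat) (A : 'M[R]_(m, p)) : R :=
  Num.sqrt (\sum_(i < m) \sum_(j < p) A i j ^+ 2).

Definition is_svals (d : nat) (A : 'M[R]_d) (s : seq R) : Prop :=
  [/\ size s = d, sorted (fun a b => b <= a) s, all (fun a => 0 <= a) s &
    exists U V : 'M[R]_d,
      [/\ U^T *m U = 1%:M, V^T *m V = 1%:M &
          A = U *m diag_mx (\row_(i < d) s`_i) *m V^T]].

Definition svals (d : nat) (A : 'M[R]_d) : seq R := xget [::] (is_svals A).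

(* sigma A i = (i+1)-th largest singular value of A (0-based index i : 'I_d) *)
Definition sigma (d : nat) (A : 'M[R]_d) (i : 'I_d) : R := (svals A)`_i.

Fixpoint prodW (d : nat) (Ws : nat -> 'M[R]_d) (l : nat) : 'M[R]_d :=
  if l is l'.+1 then Ws l'.+1 *m prodW Ws l' else 1%:M.

Section Data.
Variables (K n d : nat).
Variable X : 'M[R]_(d, K * n).

Definition xs (k : 'I_K) (i : 'I_n) : 'cV[R]_d := col (mxvec_index k i) X.

(* one-hot label matrix: column of sample (k,i) is e_k *)
Definition Ylab : 'M[R]_(K, K * n) :=
  \matrix_(r < K, c < K * n) (if [exists i : 'I_n, c == mxvec_index r i] then 1 else 0).

Variable Ws : nat -> 'M[R]_d.

Definition zf (l : nat) (k : 'I_K) (i : 'I_n) : 'cV[R]_d := prodW Ws l *m xs k i.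
Definition zbark (l : nat) (k : 'I_K) : 'cV[R]_d := (n%:R)^-1 *: \sum_(i < n) zf l k i.
Definition zbar (l : nat) : 'cV[R]_d := (K%:R)^-1 *: \sum_(k < K) zbark l k.

Definition SigmaW (l : nat) : 'M[R]_d :=
  ((K * n)%:R)^-1 *: \sum_(k < K) \sum_(i < n)
     ((zf l k i - zbark l k) *m (zf l k i - zbark l k)^T).
Definition SigmaB (l : nat) : 'M[R]_d :=
  (K%:R)^-1 *: \sum_(k < K) ((zbark l k - zbar l) *m (zbark l k - zbar l)^T).

Definition Dsep (l : nat) : R := \tr (SigmaW l) / \tr (SigmaB l).
End Data.
End Defs.

(* Main.v *)
Require Import Defs.
From HB Require Import structures.
From mathcomp Require Import all_boot all_order all_algebra.
From mathcomp Require Import boolp classical_sets reals exp.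
From mathcomp Require Import ring lra zify.
Import Order.TTheory GRing.Theory Num.Theory.
Local Open Scope ring_scope.

(** Write [S = W_1^T W_1 = V diag(lam) V^T].  Balancedness gives
    [W_{l:1}^T W_{l:1} = S^l], so with [H = Y X^T V] (whose rows are orthogonal of
    squared norm [n]) and [c_i] the squared norm of the [i]-th column of [H],
    the traces of the two covariances at layer [l] are, up to the factor [1/N],
    [\sum_i lam_i^l (1 - c_i / n)] and [\sum_i lam_i^l q_i], where
    [0 <= q_i <= c_i / n] and [\sum_i q_i = K - 1].
    Approximate balancedness of the last layer gives
    [c_i = lam_i^(L-1) (lam_i + e_i)], the [e_i] being diagonal entries of a matrix
    [B^T B - diag(lam)] of Frobenius norm at most [delta = eps^2 sqrt(d - K)], with [B]
    of rank [K].  Hence [\sum_(i >= K) lam_i^2 <= delta^2], and since [d - 2K] of the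
    [lam_i] equal [eps^2], every [lam_i] with [i >= K] is at most [sqrt K eps^2].
    The mass [c] therefore sits almost entirely on the [K] largest eigenvalues, which
    are at least [1]: the between-class trace essentially does not decrease with [l],
    while the within-class trace is dominated by the small eigenvalues and contracts
    by a factor of order [sqrt K eps^2]. *)

(** The trace form turns norm estimates into cyclicity of the trace combined with projection
    identities. *)
Definition sqfrob {R : realType} {m p : nat} (A : 'M[R]_(m, p)) : R :=
  \tr (A^T *m A).

Definition dmx {R : realType} {d : nat} (f : 'I_d -> R) : 'M[R]_d :=
  diag_mx (\row_i f i).

(** * Frobenius norms, orthogonal projections and diagonal approximation *)

Section MatrixFacts.
Variable R : realType.

Lemma sqfrobE m p (A : 'M[R]_(m, p)) :
  sqfrob A = \sum_(i < m) \sum_(j < p) A i j ^+ 2.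
Proof.
rewrite exchange_big /sqfrob; apply: eq_bigr => j _; rewrite mxE.
by apply: eq_bigr => i _; rewrite mxE expr2.
Qed.

Lemma sqfrob_ge0 m p (A : 'M[R]_(m, p)) : 0 <= sqfrob A.
Proof.
by rewrite sqfrobE; apply: sumr_ge0 => i _; apply: sumr_ge0 => j _; exact: sqr_ge0.
Qed.

Lemma sqfrob_eq0 m p (A : 'M[R]_(m, p)) : sqfrob A = 0 -> A = 0.
Proof.
rewrite sqfrobE => /eqP; rewrite psumr_eq0; last first.
  by move=> i _; apply: sumr_ge0 => j _; exact: sqr_ge0.
move=> /allP A0; apply/matrixP => i j; rewrite mxE; apply/eqP.
have /implyP/(_ isT) := A0 i (mem_index_enum i).
rewrite psumr_eq0; last by move=> *; exact: sqr_ge0.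
move=> /allP /(_ j (mem_index_enum j)) /=.
by rewrite sqrf_eq0.
Qed.

Lemma sqfrob_tr m p (A : 'M[R]_(m, p)) : sqfrob A^T = sqfrob A.
Proof. by rewrite /sqfrob trmxK mxtrace_mulC. Qed.

Lemma frob_sqr m p (A : 'M[R]_(m, p)) : frob A ^+ 2 = sqfrob A.
Proof. by rewrite /frob -sqfrobE sqr_sqrtr ?sqfrob_ge0. Qed.

Lemma proj_compl d (P : 'M[R]_d) : P^T = P -> P *m P = P ->
  (1%:M - P)^T = 1%:M - P /\ (1%:M - P) *m (1%:M - P) = 1%:M - P.
Proof.
move=> PT PP; split; first by rewrite linearB /= trmx1 PT.
by rewrite mulmxBl !mulmxBr !mulmx1 mul1mx PP subrr subr0.
Qed.

Lemma sqfrob_proj m p (A : 'M[R]_(m, p)) (P : 'M[R]_p) :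
  P^T = P -> P *m P = P -> sqfrob (A *m P) = \tr (A^T *m A *m P).
Proof.
move=> PT PP; rewrite /sqfrob trmx_mul PT mxtrace_mulC !mulmxA.
by rewrite -(mulmxA A) PP mxtrace_mulC mulmxA.
Qed.

(** Pythagoras: the difference of the two sides is the squared norm of [A *m (1 - P)]. *)
Lemma sqfrob_proj_le m p (A : 'M[R]_(m, p)) (P : 'M[R]_p) :
  P^T = P -> P *m P = P -> sqfrob (A *m P) <= sqfrob A.
Proof.
move=> PT PP; have [QT QQ] := proj_compl _ P PT PP.
rewrite -subr_ge0.
suff -> : sqfrob A - sqfrob (A *m P) =
    sqfrob (A *m (1%:M - P)) by exact: sqfrob_ge0.
by rewrite !sqfrob_proj // mulmxBr mulmx1 linearB.
Qed.

Lemma sqfrob_diag_le d (A : 'M[R]_d) : \sum_(i < d) A i i ^+ 2 <= sqfrob A.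
Proof.
rewrite sqfrobE; apply: ler_sum => i _; rewrite (bigD1 i) //= lerDl.
by apply: sumr_ge0 => j _; exact: sqr_ge0.
Qed.

Lemma dmxM d (f g : 'I_d -> R) : dmx f *m dmx g = dmx (fun i => f i * g i).
Proof. by rewrite /dmx mulmx_diag; congr diag_mx; apply/rowP => i; rewrite !mxE. Qed.

Lemma tr_dmx d (f : 'I_d -> R) : (dmx f)^T = dmx f.
Proof. exact: tr_diag_mx. Qed.

Lemma eq_dmx d (f g : 'I_d -> R) : f =1 g -> dmx f = dmx g.
Proof. by move=> fg; congr diag_mx; apply/rowP => i; rewrite !mxE. Qed.

Lemma mxtrace_dmxM d (f : 'I_d -> R) (A : 'M[R]_d) :
  \tr (dmx f *m A) = \sum_i f i * A i i.
Proof. by apply: eq_bigr => i _; rewrite mul_diag_mx !mxE. Qed.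

Lemma proj_diag_ge0 d (P : 'M[R]_d) i : P^T = P -> P *m P = P -> 0 <= P i i.
Proof.
move=> PT PP; rewrite -PP mxE; apply: sumr_ge0 => j _.
by rewrite -{1}PT mxE -expr2 sqr_ge0.
Qed.

Lemma proj_diag_le1 d (P : 'M[R]_d) i : P^T = P -> P *m P = P -> P i i <= 1.
Proof.
move=> PT PP; have [QT QQ] := proj_compl d P PT PP.
by have := proj_diag_ge0 d _ i QT QQ; rewrite !mxE eqxx /= subr_ge0.
Qed.

Lemma sum_below_const (d K : nat) (x : R) : (K <= d)%N ->
  \sum_(i < d | ~~ (K <= i)%N) x = K%:R * x.
Proof.
move=> Kd; under eq_bigl do rewrite -ltnNge.
by rewrite -(big_ord_widen d (fun=> x) Kd) sumr_const card_ord mulr_natl.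
Qed.

(** The weights [1 - p i] lie in [0, 1] and have total [d - K], so the weighted sum is smallest when
    they fill exactly the [d - K] smallest values of [f]. *)
Lemma bathtub (d K : nat) (f p : 'I_d -> R) :
  (K < d)%N -> (forall i j : 'I_d, (i <= j)%N -> f j <= f i) ->
  (forall i, 0 <= p i <= 1) -> \sum_i p i = K%:R ->
  \sum_(i < d | (K <= i)%N) f i <= \sum_i f i * (1 - p i).
Proof.
move=> Kd fdec p01 sp.
(* The value at index [K] separates the two blocks: the weight missing below is priced at most [t],
   the weight present above at least [t], and [h3] says that both amounts agree. *)
pose t := f (Ordinal Kd).
rewrite [leRHS](bigID (fun i : 'I_d => (K <= i)%N)) /=.
rewrite -subr_ge0.
have -> : \sum_(i < d | (K <= i)%N) f i * (1 - p i) =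
  \sum_(i < d | (K <= i)%N) f i - \sum_(i < d | (K <= i)%N) f i * p i.
  by rewrite -sumrB; apply: eq_bigr => i _; rewrite mulrBr mulr1.
have h1 : \sum_(i < d | (K <= i)%N) f i * p i <= \sum_(i < d | (K <= i)%N) t * p i.
  apply: ler_sum => i Ki; apply: ler_wpM2r; first by case/andP: (p01 i).
  exact: fdec.
have h2 : \sum_(i < d | ~~ (K <= i)%N) t * (1 - p i) <= \sum_(i < d | ~~ (K <= i)%N) f i * (1 - p i).
  apply: ler_sum => i Ki; apply: ler_wpM2r; first by rewrite subr_ge0; case/andP: (p01 i).
  by apply: fdec; rewrite /= ltnW // ltnNge.
have h3 : \sum_(i < d | ~~ (K <= i)%N) t * (1 - p i) = \sum_(i < d | (K <= i)%N) t * p i.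
  have spl := bigID (fun i : 'I_d => (K <= i)%N) xpredT p (op := +%R) (idx := 0).
  rewrite -!mulr_sumr; congr (_ * _); rewrite sumrB.
  by rewrite sum_below_const ?(ltnW Kd) // mulr1 -sp spl addrK.
lra.
Qed.

Lemma gram_unitmx (K d : nat) (B : 'M[R]_(K, d)) :
  (forall u : 'rV[R]_K, u *m B = 0 -> u = 0) -> B *m B^T \in unitmx.
Proof.
move=> Binj; rewrite -row_free_unit; apply: inj_row_free => u uBB.
apply: Binj; rewrite -[_ *m _]trmxK -trmx0; congr trmx; apply: sqfrob_eq0.
by rewrite /sqfrob trmxK trmx_mul !mulmxA -(mulmxA u) uBB mul0mx mxtrace0.
Qed.

(* Multiply by the orthogonal projection onto the kernel of [B], which kills the Gram matrix. *)
Lemma diag_approx_lower (K d : nat) (B : 'M[R]_(K, d)) (lam : 'I_d -> R) :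
  (K < d)%N -> (forall i, 0 <= lam i) ->
  (forall i j : 'I_d, (i <= j)%N -> lam j <= lam i) ->
  (forall u : 'rV[R]_K, u *m B = 0 -> u = 0) ->
  \sum_(i < d | (K <= i)%N) lam i ^+ 2 <= sqfrob (B^T *m B - dmx lam).
Proof.
move=> Kd lam0 lamdec /gram_unitmx BB.
pose P := B^T *m invmx (B *m B^T) *m B.
have PT : P^T = P.
  by rewrite /P !trmx_mul trmxK trmx_inv trmx_mul trmxK mulmxA.
have BP : B *m P = B by rewrite /P !mulmxA mulmxV // mul1mx.
have PP : P *m P = P by rewrite {1}/P -mulmxA BP.
have [QT QQ] := proj_compl d P PT PP.
(* The trace of the projection onto the row space of [B] is its rank; this supplies the total [K]
   that [bathtub] requires. *)
have trP : \sum_i P i i = K%:R.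
  by rewrite -/(\tr P) /P -mulmxA mxtrace_mulC -mulmxA mulVmx // mxtrace1.
clearbody P; apply: le_trans (sqfrob_proj_le _ _ _ _ QT QQ).
rewrite mulmxBl -mulmxA (mulmxBr B) mulmx1 BP subrr mulmx0 sub0r.
have NN : (- dmx lam)^T *m (- dmx lam) = dmx (fun i => lam i * lam i).
  by rewrite [(- _)^T]linearN /= mulNmx mulmxN opprK tr_dmx dmxM.
rewrite -mulNmx sqfrob_proj // NN mxtrace_dmxM.
under [leRHS]eq_bigr do rewrite -expr2 !mxE eqxx /=.
apply: (bathtub d K (fun i => lam i ^+ 2)) => //.
  by move=> i j ij; rewrite ler_sqr ?nnegrE // lamdec.
by move=> i /=; rewrite proj_diag_ge0 // proj_diag_le1.
Qed.
End MatrixFacts.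

(** * Singular values, Gram matrices of balanced products, and the last layer *)

Section Network.
Variable R : realType.

(** The default of [xget] is [[::]], whose entries all read as 0, so a nonzero entry certifies that
    a genuine list of singular values was chosen. *)
Lemma svals_spec d (A : 'M[R]_d) (i : 'I_d) : sigma A i != 0 -> is_svals A (svals A).
Proof.
by rewrite /sigma /svals; case: xgetP => [s _ //|_]; rewrite nth_nil eqxx.
Qed.

Section Balanced.
Variables (d m : nat) (Ws : nat -> 'M[R]_d).
Hypothesis bal : forall l, (1 <= l <= m)%N ->
  (Ws l.+1)^T *m Ws l.+1 = Ws l *m (Ws l)^T.

(** Each use of balancedness moves the Gram matrix one layer down, until it comes out on the right
    as that of the first layer. *)
Lemma balanced_intertwine l : (l <= m)%N ->
  (Ws l.+1)^T *m Ws l.+1 *m prodW Ws l = prodW Ws l *m ((Ws 1)^T *m Ws 1).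
Proof.
elim: l => [|l IH] lm; first by rewrite mulmx1 mul1mx.
have := IH (ltnW lm); set S := (Ws 1)^T *m Ws 1 => IHl.
rewrite bal //= -mulmxA [in LHS](mulmxA (Ws l.+1)^T).
by rewrite IHl mulmxA.
Qed.

(** By intertwining, each new layer multiplies the Gram matrix on the right by [W_1^T W_1]. The
    range reaches [m.+1] because the last step only intertwines past [m] layers. *)
Lemma balanced_gram (V : 'M[R]_d) (lam : 'I_d -> R) l :
  V^T *m V = 1%:M -> (Ws 1)^T *m Ws 1 = V *m dmx lam *m V^T -> (l <= m.+1)%N ->
  (prodW Ws l)^T *m prodW Ws l = V *m dmx (fun i => lam i ^+ l) *m V^T.
Proof.
move=> VV W1; elim: l => [|l IH] lm.
  rewrite /= trmx1 mulmx1 (_ : dmx _ = 1%:M) ?mulmx1 ?(mulmx1C VV) //.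
  by apply/matrixP => i j; rewrite !mxE.
rewrite /= trmx_mul mulmxA -[_ *m (Ws l.+1)]mulmxA -mulmxA balanced_intertwine // mulmxA.
rewrite IH ?(ltnW lm) // W1 !mulmxA -(mulmxA _ V^T) VV mulmx1 -(mulmxA V) dmxM.
by congr (_ *m _ *m _); apply: eq_dmx => i; rewrite exprSr.
Qed.

End Balanced.

(* [B] is [WL] written in the (partial) orthonormal basis obtained by
   normalising the columns of [G *m V]. *)
Lemma last_layer_basis (K d p : nat) (WL : 'M[R]_(K, d)) (G M V : 'M[R]_d)
    (sg : 'I_d -> R) :
  (0 < p)%N -> V^T *m V = 1%:M ->
  G^T *m G = V *m dmx (fun i => (sg i ^+ 2) ^+ p) *m V^T ->
  M *m G = G *m (V *m dmx (fun i => sg i ^+ 2) *m V^T) ->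
  exists B : 'M[R]_(K, d), WL *m G *m V = B *m dmx (fun i => sg i ^+ p) /\
    sqfrob (B^T *m B - dmx (fun i => sg i ^+ 2)) <=
    sqfrob (WL^T *m WL - M).
Proof.
move=> p0 VV GG MG.
have z0 : (0 : R) ^+ p = 0 by rewrite expr0n gtn_eqF.
pose H := G *m V.
have HH : H^T *m H = dmx (fun i => (sg i ^+ 2) ^+ p).
  by rewrite /H trmx_mul -mulmxA (mulmxA G^T) GG !mulmxA VV mul1mx -mulmxA VV mulmx1.
have MH : M *m H = H *m dmx (fun i => sg i ^+ 2).
  by rewrite /H mulmxA MG -!mulmxA VV mulmx1.
(* As 0 has inverse 0, [N] is the pseudo-inverse of the diagonal matrix of the [sg i ^+ p], and [J]
   projects onto the directions with nonzero singular value. *)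
pose N := dmx (fun i => (sg i ^+ p)^-1).
pose J : 'M[R]_d := dmx (fun i => (sg i != 0)%:R).
have JT : J^T = J by exact: tr_dmx.
have JJ : J *m J = J.
  by rewrite dmxM; apply: eq_dmx => i; case: eqP => _; rewrite ?mulr0 ?mulr1.
(* The columns of [H] with [sg i = 0] have norm zero, so cutting them off loses nothing; hence [U]
   below is a partial isometry. *)
have HJ : H *m J = H.
  apply/esym/eqP; rewrite -subr_eq0 -{1}[H]mulmx1 -mulmxBr; apply/eqP/sqfrob_eq0.
  have [QT QQ] := proj_compl R d J JT JJ.
  rewrite sqfrob_proj // HH mxtrace_dmxM big1 // => i _.
  rewrite !mxE eqxx /=; case: eqP => [->|_]; last by rewrite subrr mulr0.
  by rewrite expr0n /= z0 mul0r.
pose U := H *m N.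
have UU : U^T *m U = J.
  rewrite /U trmx_mul tr_dmx -mulmxA (mulmxA H^T) HH !dmxM; apply: eq_dmx => i.
  case: eqP => [->|/eqP s0]; first by rewrite z0 invr0 mul0r.
  by rewrite -exprM mulnC exprM -[X in X^-1]expr1 -[RHS]/1; field; rewrite expf_neq0.
have UJ : U *m J = U.
  rewrite /U -mulmxA dmxM; congr (_ *m _); apply: eq_dmx => i.
  case: eqP => [->|_]; last by rewrite mulr1.
  by rewrite z0 invr0 mul0r.
have UN : U *m dmx (fun i => sg i ^+ p) = H.
  rewrite -[RHS]HJ /U -mulmxA dmxM; congr (_ *m _); apply: eq_dmx => i.
  case: eqP => [->|/eqP s0]; first by rewrite z0 mulr0.
  by rewrite mulVf ?expf_neq0.
have UMU : U^T *m M *m U = dmx (fun i => sg i ^+ 2).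
  rewrite -mulmxA /U (mulmxA M) MH -(mulmxA H) (_ : dmx _ *m N = N *m dmx (fun i => sg i ^+ 2)); last first.
    by rewrite !dmxM; apply: eq_dmx => i; rewrite mulrC.
  rewrite (mulmxA H) mulmxA UU dmxM; apply: eq_dmx => i.
  by case: eqP => [->|_]; rewrite ?mul1r // expr0n mulr0.
have PT : (U *m U^T)^T = U *m U^T by rewrite trmx_mul trmxK.
have PP : (U *m U^T) *m (U *m U^T) = U *m U^T.
  by rewrite -mulmxA (mulmxA U^T) UU mulmxA UJ.
exists (WL *m U); split; first by rewrite -[RHS]mulmxA UN mulmxA.
rewrite -UMU.
have -> : (WL *m U)^T *m (WL *m U) - U^T *m M *m U = U^T *m (WL^T *m WL - M) *m U.
  by rewrite trmx_mul mulmxBr mulmxBl !mulmxA.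
(* A partial isometry on the right does not increase the norm; transposition gives the same on the
   left. *)
have step (A : 'M[R]_d) : sqfrob (A *m U) <= sqfrob A.
  apply: le_trans (sqfrob_proj_le _ _ _ A _ PT PP).
  by rewrite (sqfrob_proj _ _ _ A _ PT PP) /sqfrob trmx_mul -!mulmxA mxtrace_mulC !mulmxA.
apply: (le_trans (step _)). rewrite -sqfrob_tr. rewrite trmx_mul trmxK.
by apply: (le_trans (step _)); rewrite sqfrob_tr.
Qed.

(** * Covariance traces as traces against the Gram matrix of the features *)

Lemma mulmx_tr_col p q (A : 'M[R]_(p, q)) :
  A *m A^T = \sum_c col c A *m (col c A)^T.
Proof.
apply/matrixP => i j; rewrite mxE summxE; apply: eq_bigr => c _.
by rewrite [RHS]mxE big_ord1 !mxE.
Qed.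

Section Separation.
Variables (K n d : nat) (X : 'M[R]_(d, K * n)) (Ws : nat -> 'M[R]_d).
Hypotheses (K0 : (0 < K)%N) (n0 : (0 < n)%N).

Lemma YlabE r k i : Ylab R K n r (mxvec_index k i) = (r == k)%:R.
Proof.
have inj := bij_inj (onT_bij (curry_mxvec_bij K n)).
rewrite mxE; case: ifPn => [/existsP[j /eqP E]|/existsPn H].
  by have [-> _] := inj (k, i) (r, j) E; rewrite eqxx.
by case: eqP => // rk; have := H i; rewrite rk eqxx.
Qed.

Lemma sum_mxvec_index (M : nmodType) (F : 'I_(K * n) -> M) :
  \sum_c F c = \sum_(k < K) \sum_(i < n) F (mxvec_index k i).
Proof.
rewrite pair_big /= (reindex (uncurry (@mxvec_index K n))) /=.
  by apply: eq_bigr => -[].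
exact: curry_mxvec_bij.
Qed.

Lemma Ylab_gram : Ylab R K n *m (Ylab R K n)^T = n%:R%:M.
Proof.
apply/matrixP => r s; rewrite !mxE sum_mxvec_index (bigD1 r) //=.
rewrite [X in _ + X]big1 => [|k kr]; last first.
  apply: big1 => i _; rewrite [_^T _ _]mxE !YlabE.
  by rewrite eq_sym (negPf kr) mul0r.
rewrite addr0; under eq_bigr do rewrite [_^T _ _]mxE !YlabE eqxx mul1r.
by rewrite sumr_const card_ord eq_sym; case: eqP => _; rewrite ?mul0rn.
Qed.

Local Notation Y := (Ylab R K n).
Local Notation C := (Y *m X^T).
Local Notation Z l := (prodW Ws l).

Lemma Ylab_col k i : Y *m delta_mx (mxvec_index k i) 0 = delta_mx k 0 :> 'cV[R]_K.
Proof.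
by rewrite -colE; apply/colP => r; rewrite mxE YlabE mxE andbT.
Qed.

Lemma Ylab_tr_col k :
  Y^T *m delta_mx k 0 = \sum_(i < n) delta_mx (mxvec_index k i) 0 :> 'cV[R]_(K * n).
Proof.
rewrite -colE; apply/colP => c; case/mxvec_indexP: c => k' i'.
rewrite mxE mxE YlabE summxE.
have inj := bij_inj (onT_bij (curry_mxvec_bij K n)).
case: eqP => [->|kk']; last first.
  rewrite big1 // => i _; rewrite mxE andbT; case: eqP => // E.
  by have [/esym] := inj (k', i') (k, i) E.
rewrite (bigD1 i') //= mxE !eqxx big1 ?addr0 // => i ii'.
rewrite mxE andbT; case: eqP => // E.
by have [/esym /eqP] := inj (k', i') (k', i) E; rewrite (negPf ii').
Qed.

Lemma zfE l k i : zf X Ws l k i = Z l *m X *m delta_mx (mxvec_index k i) 0.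
Proof. by rewrite /zf /xs colE mulmxA. Qed.

Lemma zbarkE l k : zbark X Ws l k = n%:R^-1 *: (Z l *m X *m Y^T *m delta_mx k 0).
Proof.
rewrite /zbark -mulmxA Ylab_tr_col mulmx_sumr.
by under eq_bigr do rewrite zfE.
Qed.

Lemma zbarE l : zbar X Ws l =
  n%:R^-1 *: (Z l *m X *m Y^T *m (K%:R^-1 *: const_mx 1)).
Proof.
rewrite /zbar; under eq_bigr do rewrite zbarkE.
rewrite -scaler_sumr scalerA mulrC -scalerA -mulmx_sumr -scalemxAr; congr (_ *: (_ *: (_ *m _))).
apply/colP => r; rewrite summxE mxE (bigD1 r) //= mxE !eqxx big1 ?addr0 // => i ir.
by rewrite mxE eq_sym (negPf ir).
Qed.

Hypothesis XX : X *m X^T = 1%:M.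

(** Subtracting class means is right multiplication by [1 - Y^T Y / n], a projection because
    [Y Y^T = n]; orthogonality of [X] then carries it to the feature side. *)
Lemma trSigmaW l : \tr (SigmaW X Ws l) =
  (K * n)%:R^-1 * \tr ((Z l)^T *m Z l *m (1%:M - n%:R^-1 *: (C^T *m C))).
Proof.
have nz : n%:R != 0 :> R by rewrite pnatr_eq0 -lt0n.
pose P : 'M[R]_(K * n) := n%:R^-1 *: (Y^T *m Y).
have PT : P^T = P by rewrite linearZ /= trmx_mul trmxK.
have PP : P *m P = P.
  rewrite /P -scalemxAl -scalemxAr scalerA mulmxA -(mulmxA _ Y) Ylab_gram.
  by rewrite mul_mx_scalar -scalemxAl scalerA mulrVK ?unitfE.
have [QT QQ] := proj_compl _ _ P PT PP.
have colQ k i : zf X Ws l k i - zbark X Ws l k =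
    col (mxvec_index k i) (Z l *m X *m (1%:M - P)).
  rewrite zfE zbarkE colE mulmxBr mulmx1 mulmxBl; congr (_ - _).
  by rewrite /P -scalemxAr -scalemxAl -!mulmxA Ylab_col.
rewrite /SigmaW linearZ /=; congr (_ * _).
under eq_bigr do under eq_bigr do rewrite colQ.
rewrite -(sum_mxvec_index _ (fun c => col c _ *m (col c _)^T)) -mulmx_tr_col.
have -> (W : 'M[R]_(d, K * n)) :
    W *m (1%:M - P) *m (W *m (1%:M - P))^T = W *m (1%:M - P) *m W^T.
  by rewrite trmx_mul QT mulmxA -(mulmxA W) QQ.
have -> : \tr (Z l *m X *m (1%:M - P) *m (Z l *m X)^T) =
    \tr ((Z l)^T *m Z l *m (X *m (1%:M - P) *m X^T)).
  by rewrite trmx_mul (mulmxA _ X^T) mxtrace_mulC !mulmxA.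
congr (\tr (_ *m _)).
rewrite mulmxBr mulmx1 mulmxBl XX; congr (_ - _).
by rewrite /P -scalemxAr -scalemxAl trmx_mul trmxK !mulmxA.
Qed.

(** The orthogonal projection onto the complement of the all-ones vector. *)
Definition centering : 'M[R]_K := 1%:M - K%:R^-1 *: const_mx 1.

Lemma centering_tr : centering^T = centering.
Proof. by rewrite linearB /= trmx1 linearZ /= trmx_const. Qed.

Lemma centering_idem : centering *m centering = centering.
Proof.
have Kz : K%:R != 0 :> R by rewrite pnatr_eq0 -lt0n.
pose P : 'M[R]_K := K%:R^-1 *: const_mx 1.
have PT : P^T = P by rewrite linearZ /= trmx_const.
have PP : P *m P = P.
  apply/matrixP => i j; rewrite !mxE; under eq_bigr do rewrite !mxE !mulr1.
  by rewrite sumr_const card_ord -mulr_natr ?mulr1; field.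
by have [] := proj_compl _ _ P PT PP.
Qed.

(** The class means are the columns of [Z_l C^T / n], and [centering] subtracts their average. One
    of the two factors [1 / n] goes into the prefactor, which then matches that of [trSigmaW]. *)
Lemma trSigmaB l : \tr (SigmaB X Ws l) =
  (K * n)%:R^-1 * \tr ((Z l)^T *m Z l *m (n%:R^-1 *: (C^T *m centering *m C))).
Proof.
have colJ k : zbark X Ws l k - zbar X Ws l =
    col k (n%:R^-1 *: (Z l *m C^T *m centering)).
  rewrite zbarkE zbarE colE -scalemxAl -scalerBr -mulmxBr trmx_mul trmxK !mulmxA.
  congr (_ *: _); rewrite -!mulmxA; congr (_ *m (_ *m (_ *m _))).
  rewrite mulmxBl mul1mx -scalemxAl -colE; congr (_ - _ *: _).
  by apply/colP => i; rewrite !mxE.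
rewrite /SigmaB linearZ /=; under eq_bigr do rewrite colJ.
rewrite -(mulmx_tr_col _ _ (n%:R^-1 *: _)).
rewrite linearZ /= -scalemxAl -scalemxAr !linearZ /= natrM invfM -!mulrA.
congr (_ * (_ * (_ * _))).
have -> (W : 'M[R]_(d, K)) : W *m centering *m (W *m centering)^T = W *m centering *m W^T.
  by rewrite trmx_mul centering_tr mulmxA -(mulmxA W) centering_idem.
by rewrite (trmx_mul (Z l)) trmxK (mulmxA _ C) mxtrace_mulC !mulmxA.
Qed.
End Separation.
End Network.

(** * Scalar estimates on the spectral sums, for depth [m + 2] and [s] the root of that order of
    [n] *)

Section SpectralSums.
Variables (R : realType) (d K m n : nat) (lam e c q : 'I_d -> R) (s delta a : R).
Hypotheses (Kd : (K < d)%N) (K2 : (2 <= K)%N) (n2 : (2 <= n)%N).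
Hypotheses (lam0 : forall i, 0 <= lam i).
Hypothesis lam_dec : forall i j : 'I_d, (i <= j)%N -> lam j <= lam i.
Hypothesis cE : forall i, c i = lam i ^+ m.+1 * (lam i + e i).
Hypothesis cn : forall i, 0 <= c i <= n%:R.
Hypothesis sum_c : \sum_i c i = n%:R * K%:R.
Hypothesis sum_e : \sum_i e i ^+ 2 <= delta ^+ 2.
Hypothesis sum_lam : \sum_(i < d | (K <= i)%N) lam i ^+ 2 <= delta ^+ 2.
Hypothesis lam_a : forall i : 'I_d, (K <= i)%N -> lam i <= a.
Hypotheses (a_half : a <= 1 / 2) (delta0 : 0 <= delta) (delta_s : delta <= s / 120).
Hypotheses (s1 : 1 <= s) (s_n : s ^+ m.+2 = n%:R).
Hypothesis q_c : forall i, 0 <= q i <= c i / n%:R.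
Hypothesis sum_q : \sum_i q i = K%:R - 1.

Let lam_half (i : 'I_d) : (K <= i)%N -> lam i <= 1 / 2.
Proof. by move=> Ki; apply: le_trans (lam_a i Ki) a_half. Qed.

Let nR : 2 <= n%:R :> R.
Proof. by rewrite ler_nat. Qed.

Let n0 : 0 < n%:R :> R.
Proof. by have := nR; lra. Qed.

Let e_delta i : `|e i| <= delta.
Proof.
rewrite -ler_sqr ?nnegrE // real_normK ?num_real //; apply: le_trans sum_e.
by rewrite (bigD1 i) //= lerDl sumr_ge0 // => j _; exact: sqr_ge0.
Qed.

Let s_sqr : s ^+ 2 <= n%:R.
Proof. by rewrite -s_n ler_weXn2l. Qed.

Let s_le_n : s <= n%:R.
Proof. by rewrite -s_n -{1}[s]expr1 ler_weXn2l. Qed.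

Let delta_sqr : delta ^+ 2 <= n%:R / 14400.
Proof.
have : delta ^+ 2 <= (s / 120) ^+ 2 .
  rewrite ler_sqr ?nnegrE //. by have := s1; lra.
have -> : (s / 120) ^+ 2 = s ^+ 2 / 14400 by field.
have := s_sqr; lra.
Qed.

Let pow_le (i : 'I_d) k : (K <= i)%N -> (1 <= k <= m.+1)%N -> lam i ^+ m.+1 <= lam i ^+ k.
Proof.
move=> Ki /andP[_ km]; apply: ler_wiXn2l => //.
by have := lam_half i Ki; lra.
Qed.

(** For small [lam i] the power is at most [lam i], so [c i <= lam i * (lam i + |e i|)]; AM-GM on
    the cross term bounds the sum by [2 * delta ^+ 2], and [delta <= s / 120] gives 7200. *)
Lemma bottom_mass : \sum_(i < d | (K <= i)%N) c i <= n%:R / 7200.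
Proof.
have H : \sum_(i < d | (K <= i)%N) c i <=
   \sum_(i < d | (K <= i)%N) (3 / 2 * lam i ^+ 2 + 1 / 2 * e i ^+ 2).
  apply: ler_sum => i Ki; rewrite cE.
  have h1 := pow_le i 1 Ki isT; rewrite expr1 in h1.
  have h2 : 0 <= lam i ^+ m.+1 by rewrite exprn_ge0.
  have h3 := lam0 i.
  have : lam i ^+ m.+1 * (lam i + e i) <= lam i * (lam i + `|e i|).
    apply: (@le_trans _ _ (lam i ^+ m.+1 * (lam i + `|e i|))).
      by apply: ler_wpM2l => //; rewrite lerD2l ler_norm.
    by apply: ler_wpM2r => //; rewrite addr_ge0.
  have : `|e i| ^+ 2 = e i ^+ 2 by rewrite real_normK ?num_real.
  have := sqr_ge0 (lam i - `|e i|); nra.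
apply: (le_trans H); rewrite big_split /= -!mulr_sumr.
have : \sum_(i < d | (K <= i)%N) e i ^+ 2 <= delta ^+ 2.
  apply: le_trans sum_e; rewrite [leRHS](bigID (fun i : 'I_d => (K <= i)%N)) /= lerDl.
  by apply: sumr_ge0 => i _; exact: sqr_ge0.
have := sum_lam; have := delta_sqr; lra.
Qed.

(** The [c i] total [n * K] and none exceeds [n], so a single top entry can fall short of [n] by at
    most the bottom mass. *)
Lemma top_c (i : 'I_d) : (i < K)%N -> n%:R * (1 - 1 / 7200) <= c i.
Proof.
move=> iK.
have card_top : \sum_(j < d | ~~ (K <= j)%N) (n%:R : R) = n%:R * K%:R.
  by rewrite sum_below_const ?(ltnW Kd) // mulrC.
have topD (f : 'I_d -> R) : \sum_(j < d | ~~ (K <= j)%N) f j =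
    f i + \sum_(j < d | ~~ (K <= j)%N && (j != i)) f j.
  by rewrite (bigD1 i) // -ltnNge.
have := sum_c; rewrite (bigID (fun i : 'I_d => (K <= i)%N)) /= -card_top !topD.
have : \sum_(j < d | ~~ (K <= j)%N && (j != i)) c j <=
   \sum_(j < d | ~~ (K <= j)%N && (j != i)) n%:R.
  by apply: ler_sum => j _; case/andP: (cn j).
have := bottom_mass; lra.
Qed.

Let top_upper (i : 'I_d) : c i <= lam i ^+ m.+1 * (lam i + delta).
Proof.
rewrite cE; apply: ler_wpM2l; first exact: exprn_ge0.
by rewrite lerD2l; apply: le_trans (e_delta i); rewrite ler_norm.
Qed.

(** Otherwise [c i] would be at most [1 + delta], too small for a value close to [n >= 2]. *)
Lemma top_lam_ge1 (i : 'I_d) : (i < K)%N -> 1 <= lam i.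
Proof.
move=> iK; rewrite leNgt; apply/negP => l1.
have := top_c i iK; have := top_upper i; have := lam0 i.
have : lam i ^+ m.+1 * (lam i + delta) <= lam i + delta.
  by rewrite ler_piMl ?addr_ge0 // exprn_ile1 // ltW.
have := s_le_n; have := nR; have := delta_s; lra.
Qed.

(** Otherwise [c i <= s ^+ m.+2 / 2 = n / 2], against [top_c]. A single factor 1/2 is kept from the
    power, so the bound is uniform in [m]. *)
Lemma top_lam_ge (i : 'I_d) : (i < K)%N -> s / 2 <= lam i.
Proof.
move=> iK; rewrite leNgt; apply/negP => ls.
have h0 := lam0 i; have hs := s1; have hd := delta_s; have hd0 := delta0.
have h1 : lam i ^+ m.+1 <= s ^+ m.+1 / 2.
  have : lam i ^+ m.+1 <= (s / 2) ^+ m.+1 by rewrite lerXn2r ?nnegrE //; lra.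
  move/le_trans; apply; rewrite exprMn ler_wpM2l ?exprn_ge0 //; first by lra.
  rewrite exprS ger_pMr ?invr_gt0 // exprn_ile1 //; lra.
have h2 : lam i ^+ m.+1 * (lam i + delta) <= s ^+ m.+1 / 2 * s.
  apply: ler_pM => //; [exact: exprn_ge0 | lra | lra].
have := top_c i iK; have := top_upper i; rewrite -s_n (exprSr s).
have : 0 < s ^+ m.+1 * s by rewrite mulr_gt0 ?exprn_gt0 //; lra.
lra.
Qed.

Definition within l := \sum_i lam i ^+ l * (1 - c i / n%:R).
Definition between l := \sum_i lam i ^+ l * q i.

Lemma c_over_n_le1 i : 0 <= c i / n%:R <= 1.
Proof.
have /andP[h1 h2] := cn i.
by rewrite ler_pdivrMr // mul1r h2 andbT divr_ge0 // ltW.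
Qed.

Lemma within_ge0 l : 0 <= within l.
Proof.
apply: sumr_ge0 => i _; rewrite mulr_ge0 ?exprn_ge0 //.
by rewrite subr_ge0; case/andP: (c_over_n_le1 i).
Qed.

(** As the [c i / n] sum to [K], what the top [K] of them lack to reach 1 is exactly what the others
    carry. *)
Lemma top_deficit : \sum_(i < d | ~~ (K <= i)%N) (1 - c i / n%:R) =
  \sum_(i < d | (K <= i)%N) c i / n%:R.
Proof.
rewrite sumrB sum_below_const ?(ltnW Kd) // mulr1 -!mulr_suml.
have <- : (\sum_i c i) / n%:R = K%:R by rewrite sum_c mulrAC divff ?mul1r // gt_eqF.
by rewrite (bigID (fun i : 'I_d => (K <= i)%N)) /= mulrDl addrK.
Qed.

Lemma top_pow_le (i j : 'I_d) : (i < K)%N -> (K <= j)%N ->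
  lam i ^+ m.+1 / n%:R * (lam j + delta) <= 31 / 59.
Proof.
move=> iK Kj; have h1 := top_lam_ge1 i iK; have h2 := top_lam_ge i iK.
have h3 := lam_half j Kj; have h4 := lam0 j; have hs := s1; have hd := delta_s; have hd0 := delta0.
have h5 : lam i ^+ m.+1 * (lam i - delta) <= n%:R.
  have /andP[_] := cn i; rewrite cE; apply: le_trans; apply: ler_wpM2l.
    exact: exprn_ge0.
  by rewrite lerD2l; have := e_delta i; rewrite ler_norml => /andP[].
(* From [delta <= s / 120 <= lam i / 60] and [lam j <= 1 / 2 <= lam i / 2]: the left side is at most
   31/60 of [lam i], and [lam i - delta] is at least 59/60 of it. *)
have h6 : lam j + delta <= 31 / 59 * (lam i - delta) by lra.
rewrite mulrAC ler_pdivrMr //.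
apply: (@le_trans _ _ (lam i ^+ m.+1 * (31 / 59 * (lam i - delta)))).
  by apply: ler_wpM2l => //; exact: exprn_ge0.
by rewrite mulrCA; apply: ler_wpM2l => //; lra.
Qed.

(** Both blocks of [within l.+1] are controlled by the tail power sum [B l.+1], which is at most
    [a * B l], while [within l] is almost at least [B l]. The constant 31/20 covers
    [(1 + 31 / 59) * 7200 / 7199]. *)
Lemma within_contract l : (l <= m)%N ->
  within l.+1 <= 31 / 20 * a * within l.
Proof.
move=> lm.
pose B k := \sum_(j < d | (K <= j)%N) lam j ^+ k.
have a0 : 0 <= a.
  by have := lam_a (Ordinal Kd) (leqnn K); have := lam0 (Ordinal Kd); lra.
have B0 k : 0 <= B k by apply: sumr_ge0 => j _; exact: exprn_ge0.
have BS : B l.+1 <= a * B l.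
  rewrite mulr_sumr; apply: ler_sum => j Kj; rewrite exprS.
  by apply: ler_wpM2r; [exact: exprn_ge0 | exact: lam_a].
have lower : (1 - 1 / 7200) * B l <= within l.
  rewrite /within (bigID (fun i : 'I_d => (K <= i)%N)) /=.
  apply: ler_wpDr.
    apply: sumr_ge0 => i _; rewrite mulr_ge0 ?exprn_ge0 // subr_ge0.
    by case/andP: (c_over_n_le1 i).
  rewrite mulrC mulr_suml; apply: ler_sum => j Kj; apply: ler_wpM2l; first exact: exprn_ge0.
  rewrite lerD2l lerN2 ler_pdivrMr //.
  have := bottom_mass; rewrite (bigD1 j) //=.
  have : 0 <= \sum_(i < d | (K <= i)%N && (i != j)) c i.
    by apply: sumr_ge0 => i _; case/andP: (cn i).
  lra.
have top : \sum_(i < d | ~~ (K <= i)%N) lam i ^+ l.+1 * (1 - c i / n%:R) <= 31 / 59 * B l.+1.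
  have key (i : 'I_d) (j : 'I_d) : (i < K)%N -> (K <= j)%N ->
      lam i ^+ l.+1 * (c j / n%:R) <= 31 / 59 * lam j ^+ l.+1.
    move=> iK Kj.
    (* Top values are at least 1 and bottom values at most 1/2, so passing to exponent [m.+1] and
       back only loses in the right direction. *)
    have p1 : lam i ^+ l.+1 <= lam i ^+ m.+1 by rewrite ler_weXn2l // top_lam_ge1.
    have p2 : lam j ^+ m.+1 <= lam j ^+ l.+1 by apply: pow_le.
    have cj := top_upper j; have /andP[c0 _] := cn j.
    apply: (@le_trans _ _ (lam i ^+ m.+1 * (lam j ^+ m.+1 * (lam j + delta) / n%:R))).
      apply: ler_pM => //; [exact: exprn_ge0 | by rewrite divr_ge0 // (ltW n0) | ].
      by rewrite ler_pM2r // invr_gt0.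
    have -> : lam i ^+ m.+1 * (lam j ^+ m.+1 * (lam j + delta) / n%:R) =
      lam j ^+ m.+1 * (lam i ^+ m.+1 / n%:R * (lam j + delta)) by ring.
    apply: (@le_trans _ _ (lam j ^+ m.+1 * (31 / 59))).
      by apply: ler_wpM2l; [exact: exprn_ge0 | exact: top_pow_le].
    by rewrite mulrC; apply: ler_wpM2l => //; lra.
  have d0 : (0 < d)%N by apply: leq_trans Kd.
  have i0K : (Ordinal d0 < K)%N by apply: leq_trans K2.
  (* All top eigenvalues are replaced by the largest; [top_deficit] then trades the top weights for
     bottom ones, which [key] handles term by term. *)
  apply: (@le_trans _ _ (lam (Ordinal d0) ^+ l.+1 * \sum_(i < d | ~~ (K <= i)%N) (1 - c i / n%:R))).
    rewrite mulr_sumr; apply: ler_sum => i _; apply: ler_wpM2r.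
      by rewrite subr_ge0; case/andP: (c_over_n_le1 i).
    by rewrite lerXn2r ?nnegrE // lam_dec.
  rewrite top_deficit !mulr_sumr; apply: ler_sum => j Kj; exact: key.
have bot : \sum_(i < d | (K <= i)%N) lam i ^+ l.+1 * (1 - c i / n%:R) <= B l.+1.
  apply: ler_sum => i _; rewrite ler_piMr ?exprn_ge0 //.
  by case/andP: (c_over_n_le1 i); lra.
rewrite {1}/within (bigID (fun i : 'I_d => (K <= i)%N)) /=.
have := ler_wpM2l a0 lower; have := mulr_ge0 a0 (B0 l); lra.
Qed.

Let q0 i : 0 <= q i.
Proof. by case/andP: (q_c i). Qed.

(** The top part does not decrease since its eigenvalues are at least 1, and it is at least 1/2 as
    [K - 1 >= 1]; the bottom part never exceeds 1/7200. *)
Lemma between_grow l : (l <= m)%N ->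
  0 < between l /\ between l <= 1001 / 1000 * between l.+1.
Proof.
move=> lm.
have botq : \sum_(i < d | (K <= i)%N) q i <= 1 / 7200.
  apply: (@le_trans _ _ (\sum_(i < d | (K <= i)%N) c i / n%:R)).
    by apply: ler_sum => i _; case/andP: (q_c i).
  by rewrite -mulr_suml ler_pdivrMr //; have := bottom_mass; lra.
have bot k : 0 <= \sum_(i < d | (K <= i)%N) lam i ^+ k * q i <= 1 / 7200.
  apply/andP; split; first by apply: sumr_ge0 => i _; rewrite mulr_ge0 ?exprn_ge0.
  apply: le_trans botq; apply: ler_sum => i Ki; rewrite ler_piMl // exprn_ile1 //.
  by have := lam_half i Ki; lra.
pose A k := \sum_(i < d | ~~ (K <= i)%N) lam i ^+ k * q i.
have A1 : 1 / 2 <= A l.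
  have : \sum_(i < d | ~~ (K <= i)%N) q i <= A l.
    apply: ler_sum => i; rewrite -ltnNge => iK; rewrite ler_peMl // exprn_ege1 //.
    exact: top_lam_ge1.
  have := sum_q; rewrite (bigID (fun i : 'I_d => (K <= i)%N)) /=.
  have : 2 <= K%:R :> R by rewrite ler_nat.
  lra.
have AA : A l <= A l.+1.
  apply: ler_sum => i; rewrite -ltnNge => iK; apply: ler_wpM2r => //.
  by rewrite ler_weXn2l // top_lam_ge1.
have bE k : between k = \sum_(i < d | (K <= i)%N) lam i ^+ k * q i + A k.
  by rewrite /between (bigID (fun i : 'I_d => (K <= i)%N)).
rewrite !bE; have /andP[] := bot l; have /andP[] := bot l.+1; lra.
Qed.

Lemma ratio_contract l : (l <= m)%N ->
  within l.+1 / between l.+1 / (within l / between l) <= 2 * a.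
Proof.
move=> lm; have [b0 bb] := between_grow l lm; have wc := within_contract l lm.
have b1 : 0 < between l.+1 by lra.
have a0 : 0 <= a.
  by have := lam_a (Ordinal Kd) (leqnn K); have := lam0 (Ordinal Kd); lra.
(* If [within l] vanishes, division by 0 makes the whole quotient 0. *)
have [->|w0] := eqVneq (within l) 0.
  by rewrite mul0r invr0 mulr0 mulr_ge0.
have wp : 0 < within l by rewrite lt_neqAle eq_sym w0 within_ge0.
rewrite ler_pdivrMr ?divr_gt0 // ler_pdivrMr //.
apply: (le_trans wc).
have -> : 2 * a * (within l / between l) * between l.+1 =
  a * within l * (2 * (between l.+1 / between l)) by ring.
have : 1000 / 1001 <= between l.+1 / between l by rewrite ler_pdivlMr //; lra.
have : 0 <= a * within l by rewrite mulr_ge0 // ltW.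
nra.
Qed.
End SpectralSums.

(** * From the hypotheses on the network to the scalar estimates *)

Section Assembly.
Variable R : realType.

Lemma powR_invn (x : R) (k : nat) : 0 <= x -> (0 < k)%N -> (x `^ (1 / k%:R)) ^+ k = x.
Proof.
move=> x0 k0; rewrite -powR_mulrn ?powR_ge0 // -powRrM div1r mulVf ?powRr1 //.
by rewrite pnatr_eq0 -lt0n.
Qed.

(** The witness is [n] to the power [1 / L]. Squaring the bound on [eps] yields the factor
    [30 * L ^+ 2], which is at least 120 for [L >= 2]. *)
Lemma eps_delta_bound (n D L : nat) (eps : R) : (0 < n)%N -> (0 < D)%N -> (2 <= L)%N ->
  0 < eps ->
  eps <= (n%:R) `^ (1 / (2 * L)%:R) / (Num.sqrt 30 * L%:R * (D%:R) `^ (1 / 4)) ->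
  exists s : R, [/\ 1 <= s, s ^+ L = n%:R & eps ^+ 2 * Num.sqrt D%:R <= s / 120].
Proof.
move=> n0 D0 L2 e0; set r := _ `^ _; set t := _ `^ _ => er.
have r0 : 0 <= r by exact: powR_ge0.
have t0 : 0 < t by apply: powR_gt0; rewrite ltr0n.
have rL : (r ^+ 2) ^+ L = n%:R by rewrite -exprM powR_invn ?ler0n // muln_gt0 (leq_trans _ L2).
have t2 : t ^+ 2 = Num.sqrt D%:R.
  apply/eqP; rewrite -(@eqrXn2 _ 2) ?sqrtr_ge0 ?exprn_ge0 ?(ltW t0) //.
  by rewrite sqr_sqrtr ?ler0n // -exprM (powR_invn _ 4) ?ler0n.
have L0 : 2 <= L%:R :> R by rewrite ler_nat.
have s30 : Num.sqrt 30 ^+ 2 = 30 :> R by rewrite sqr_sqrtr.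
have s30p : 0 < Num.sqrt 30 :> R by rewrite sqrtr_gt0.
exists (r ^+ 2); split => //.
  rewrite leNgt; apply/negP => r1.
  have : (r ^+ 2) ^+ L < 1 by rewrite exprn_ilt1 ?exprn_ge0 // -lt0n (leq_trans _ L2).
  by rewrite rL ltrn1 ltnNge n0.
have den : 0 < Num.sqrt 30 * L%:R * t by rewrite !mulr_gt0 //; lra.
rewrite -t2; move: er; rewrite ler_pdivlMr // => er.
have : (eps * (Num.sqrt 30 * L%:R * t)) ^+ 2 <= r ^+ 2.
  by rewrite ler_sqr ?nnegrE // mulr_ge0 ?ltW.
rewrite !exprMn s30.
have : 4 <= L%:R ^+ 2 :> R by nra.
have : 0 <= eps ^+ 2 * t ^+ 2 by rewrite mulr_ge0 ?sqr_ge0.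
nra.
Qed.

Lemma eps_a_bound (K : nat) (eps : R) : 0 < eps ->
  eps <= 1 / Num.sqrt (2 * (Num.sqrt K%:R + 1)) -> Num.sqrt K%:R * eps ^+ 2 <= 1 / 2.
Proof.
move=> e0; set k := Num.sqrt K%:R => he.
have k0 : 0 <= k by exact: sqrtr_ge0.
have y0 : 0 < 2 * (k + 1) by lra.
move: he; rewrite ler_pdivlMr ?sqrtr_gt0 // => he.
have : (eps * Num.sqrt (2 * (k + 1))) ^+ 2 <= 1 ^+ 2.
  by rewrite ler_sqr ?nnegrE ?mulr_ge0 ?sqrtr_ge0 // ltW.
rewrite exprMn sqr_sqrtr ?(ltW y0) // expr1n.
have := sqr_ge0 eps; lra.
Qed.

(* Either [A] meets the top block, and then every later value is at most [eps ^+ 2],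
   or [A] uses up all but [K * eps ^+ 4] of the available energy. *)
Lemma bottom_bound (d K : nat) (lam : 'I_d -> R) (A : {set 'I_d}) (eps : R) :
  (0 < K)%N -> (2 * K < d)%N -> 0 < eps ->
  (forall i j : 'I_d, (i <= j)%N -> lam j <= lam i) -> (forall i, 0 <= lam i) ->
  #|A| = (d - 2 * K)%N -> (forall i, i \in A -> lam i = eps ^+ 2) ->
  \sum_(i < d | (K <= i)%N) lam i ^+ 2 <= (eps ^+ 2 * Num.sqrt (d - K)%:R) ^+ 2 ->
  forall j : 'I_d, (K <= j)%N -> lam j <= Num.sqrt K%:R * eps ^+ 2.
Proof.
move=> K0 Kd e0 dec lam0 cA lamA tot j Kj.
have K1 : 1 <= Num.sqrt K%:R :> R by rewrite -[leLHS]sqrtr1 ler_wsqrtr // ler1n.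
have e2 : 0 <= eps ^+ 2 by exact: sqr_ge0.
have [le|gt] := leP (lam j) (eps ^+ 2).
  by apply: (le_trans le); rewrite ler_peMl.
have AK (i : 'I_d) : i \in A -> (K <= i)%N && (i != j).
  move=> iA; apply/andP; split; last first.
    by apply/eqP => ij; move: gt; rewrite -ij (lamA i iA) ltxx.
  rewrite leqNgt; apply/negP => iK; have := dec i j (ltnW (leq_trans iK Kj)).
  by rewrite (lamA i iA) leNgt gt.
have sA : (d - 2 * K)%:R * (eps ^+ 2) ^+ 2 + lam j ^+ 2 <=
    \sum_(i < d | (K <= i)%N) lam i ^+ 2.
  rewrite (bigD1 j) //= addrC.
  rewrite lerD2r -cA mulr_natl -sumr_const.
  rewrite [leRHS](bigID (fun i => i \in A)) /=; apply: ler_wpDr.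
    by apply: sumr_ge0 => i _; exact: sqr_ge0.
  rewrite [leRHS](eq_bigl (fun i => i \in A)); last first.
    by move=> i /=; apply: andb_idl => /AK.
  by apply: ler_sum => i iA; rewrite lamA.
have r0 : 0 <= Num.sqrt K%:R * eps ^+ 2 by rewrite mulr_ge0 ?sqrtr_ge0.
suff : lam j ^+ 2 <= (Num.sqrt K%:R * eps ^+ 2) ^+ 2 by rewrite ler_sqr ?nnegrE.
rewrite exprMn sqr_sqrtr ?ler0n //.
move: tot sA; rewrite exprMn sqr_sqrtr ?ler0n // => tot sA.
have E : (d - K)%:R = (d - 2 * K)%:R + K%:R :> R.
  by rewrite -natrD; congr _%:R; lia.
rewrite E in tot; lra.
Qed.

Lemma gram_diag_ge0 p d (A : 'M[R]_(p, d)) i : 0 <= (A^T *m A) i i.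
Proof.
by rewrite mxE; apply: sumr_ge0 => k _; rewrite mxE -expr2 sqr_ge0.
Qed.

Lemma tr_conj_dmx d (V A : 'M[R]_d) (f : 'I_d -> R) :
  \tr (V *m dmx f *m V^T *m A) = \sum_i f i * (V^T *m A *m V) i i.
Proof.
by rewrite -mxtrace_dmxM -!mulmxA mxtrace_mulC !mulmxA.
Qed.

Lemma centering_trace K : (0 < K)%N -> \tr (centering R K) = K%:R - 1.
Proof.
move=> K0; rewrite linearB /= mxtrace1 linearZ /=; congr (_ - _).
rewrite /mxtrace; under eq_bigr do rewrite mxE.
by rewrite sumr_const card_ord mulVf // pnatr_eq0 -lt0n.
Qed.

(** With one class the between-class trace is 0, and so is the quotient by it. *)
Lemma Dsep_single_class (n d : nat) (X : 'M[R]_(d, 1 * n)) Ws l :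
  (0 < n)%N -> X *m X^T = 1%:M -> Dsep X Ws l = 0.
Proof.
move=> n0 XX; rewrite /Dsep trSigmaB //.
rewrite (_ : centering R 1 = 0); last first.
  by apply/matrixP => i j; rewrite !mxE !ord1 eqxx invr1 mulr1 subrr.
by rewrite mulmx0 mul0mx scaler0 mulmx0 mxtrace0 mulr0 invr0 mulr0.
Qed.

(** Both traces are expanded in the eigenbasis [V] of the Gram matrix; their common prefactor
    cancels. *)
Lemma Dsep_spectral (K n d : nat) (X : 'M[R]_(d, K * n)) Ws (V : 'M[R]_d)
    (lam : 'I_d -> R) (H : 'M[R]_(K, d)) l :
  (0 < K)%N -> (0 < n)%N -> X *m X^T = 1%:M -> V^T *m V = 1%:M ->
  H = Ylab R K n *m X^T *m V ->
  (prodW Ws l)^T *m prodW Ws l = V *m dmx (fun i => lam i ^+ l) *m V^T ->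
  Dsep X Ws l = within R d n lam (fun i => (H^T *m H) i i) l /
    between R d lam (fun i => n%:R^-1 * (H^T *m centering R K *m H) i i) l.
Proof.
move=> K0 n0 XX VV HE gram; rewrite /Dsep trSigmaW // trSigmaB // gram !tr_conj_dmx.
have N0 : (K * n)%:R^-1 != 0 :> R by rewrite invr_eq0 pnatr_eq0 -lt0n muln_gt0 K0.
rewrite -mulf_div divff // mul1r; congr (_ / _); apply: eq_bigr => i _; congr (_ * _).
  rewrite mulmxBr mulmx1 mulmxBl VV -scalemxAr -scalemxAl HE !trmx_mul !mulmxA.
  by rewrite !mxE eqxx mulrC.
by rewrite -scalemxAr -scalemxAl HE !trmx_mul !mulmxA mxE.
Qed.

Lemma Dsep_ratio_le (K n d m : nat) (X : 'M[R]_(d, K * n)) Ws (WL : 'M[R]_(K, d)) (eps s : R)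
    (A : {set 'I_d}) :
  (2 <= K)%N -> (2 <= n)%N -> (2 * K < d)%N -> X *m X^T = 1%:M -> X^T *m X = 1%:M ->
  0 < eps -> 1 <= s -> s ^+ m.+2 = n%:R ->
  eps ^+ 2 * Num.sqrt (d - K)%:R <= s / 120 ->
  Num.sqrt K%:R * eps ^+ 2 <= 1 / 2 ->
  WL *m prodW Ws m.+1 *m X = Ylab R K n ->
  (forall l, (1 <= l <= m)%N -> (Ws l.+1)^T *m Ws l.+1 = Ws l *m (Ws l)^T) ->
  frob (WL^T *m WL - Ws m.+1 *m (Ws m.+1)^T) <= eps ^+ 2 * Num.sqrt (d - K)%:R ->
  #|A| = (d - 2 * K)%N -> (forall i, i \in A -> sigma (Ws 1) i = eps) ->
  forall l, (l <= m)%N ->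
  Dsep X Ws l.+1 / Dsep X Ws l <= 2 * (Num.sqrt K%:R * eps ^+ 2).
Proof.
move=> K2 n2 Kd XX XX' e0 s1 sn ds a_half opt bal fr cA sA l lm.
have K0 : (0 < K)%N by exact: leq_trans K2.
have n0 : (0 < n)%N by exact: leq_trans n2.
have nz : n%:R != 0 :> R by rewrite pnatr_eq0 -lt0n.
have Kd' : (K < d)%N by apply: leq_ltn_trans Kd; rewrite leq_pmull.
(* Since [d > 2K], the set [A] is nonempty, and [eps] is a nonzero singular value of [W_1]; this is
   what unlocks its decomposition. *)
have [i0 i0A] : exists i0, i0 \in A by apply/card_gt0P; rewrite cA subn_gt0.
have [|ssz ssort snn [U [V [UU VV W1]]]] := svals_spec R d (Ws 1) i0.
  by rewrite sA // gt_eqF.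
pose sg (i : 'I_d) := (svals (Ws 1))`_i.
pose lam i := sg i ^+ 2.
have sg0 i : 0 <= sg i by move/all_nthP: snn; apply; rewrite ssz.
have sg_dec (i j : 'I_d) : (i <= j)%N -> sg j <= sg i.
  move=> ij; apply: (sorted_leq_nth _ _ 0 ssort) => //; rewrite ?inE ?ssz //.
  by move=> x y z yx zy; apply: le_trans zy yx.
have lam0 i : 0 <= lam i by exact: sqr_ge0.
have lam_dec (i j : 'I_d) : (i <= j)%N -> lam j <= lam i.
  by move=> ij; rewrite ler_sqr ?nnegrE ?sg_dec.
have S1 : (Ws 1)^T *m Ws 1 = V *m dmx lam *m V^T.
  have -> : Ws 1 = U *m dmx sg *m V^T by exact: W1.
  rewrite !trmx_mul trmxK tr_dmx !mulmxA -(mulmxA _ U^T) UU mulmx1 -[in LHS](mulmxA V).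
  by rewrite dmxM; congr (_ *m _ *m _); apply: eq_dmx => i; rewrite -expr2.
have gram k : (k <= m.+1)%N -> (prodW Ws k)^T *m prodW Ws k =
    V *m dmx (fun i => lam i ^+ k) *m V^T.
  exact: (balanced_gram R d m Ws bal V lam k VV S1).
have MG : Ws m.+1 *m (Ws m.+1)^T *m prodW Ws m.+1 = prodW Ws m.+1 *m (V *m dmx lam *m V^T).
  rewrite -S1 /= -!mulmxA; congr (_ *m _); rewrite mulmxA.
  by rewrite (balanced_intertwine R d m Ws bal m (leqnn m)).
have [B [BE Bfr]] := last_layer_basis R K d m.+1 WL _ _ V sg isT VV (gram _ (leqnn _)) MG.
pose H := Ylab R K n *m X^T *m V.
have HB : H = B *m dmx (fun i => sg i ^+ m.+1).
  by rewrite -BE /H -opt -!mulmxA (mulmxA X) XX mul1mx.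
have HH : H *m H^T = n%:R%:M.
  rewrite /H !trmx_mul trmxK !mulmxA -(mulmxA _ V) (mulmx1C VV) mulmx1.
  by rewrite -(mulmxA _ X^T) XX' mulmx1 Ylab_gram.
pose E := B^T *m B - dmx lam.
set delta := eps ^+ 2 * _ in ds fr.
have delta0 : 0 <= delta by rewrite mulr_ge0 ?sqr_ge0 ?sqrtr_ge0.
have Edelta : sqfrob E <= delta ^+ 2.
  apply: (le_trans Bfr); rewrite -frob_sqr ler_sqr ?nnegrE //.
  by rewrite /frob sqrtr_ge0.
(* [B] inherits full row rank from [H], whose rows are orthogonal and nonzero. *)
have Binj (u : 'rV[R]_K) : u *m B = 0 -> u = 0.
  move=> uB; have : u *m (H *m H^T) = 0 by rewrite HB !mulmxA uB !mul0mx.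
  by rewrite HH mul_mx_scalar => /eqP; rewrite scaler_eq0 (negPf nz) => /eqP.
have tail : \sum_(i < d | (K <= i)%N) lam i ^+ 2 <= delta ^+ 2.
  by apply: le_trans Edelta; apply: diag_approx_lower.
have lam_a : forall i : 'I_d, (K <= i)%N -> lam i <= Num.sqrt K%:R * eps ^+ 2.
  apply: (bottom_bound d K lam A) => // i iA.
  by rewrite /lam; congr (_ ^+ 2); exact: sA.
pose P : 'M[R]_d := n%:R^-1 *: (H^T *m H).
have PT : P^T = P by rewrite linearZ /= trmx_mul trmxK.
have PP : P *m P = P.
  rewrite /P -scalemxAl -scalemxAr scalerA mulmxA -(mulmxA _ H) HH.
  by rewrite mul_mx_scalar -scalemxAl scalerA mulrVK ?unitfE.
pose J := centering R K.
have JT : J^T = J by exact: centering_tr.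
have JJ : J *m J = J by exact: centering_idem.
have [QT QQ] := proj_compl R K J JT JJ.
rewrite !(Dsep_spectral K n d X Ws V lam H) // ?gram // ?ltnS // ?leqW //.
apply: (ratio_contract R d K m n lam (fun i => E i i) _ _ s delta) => //.
(* [H] is [B] with columns scaled by [sg i ^+ m.+1], so [c i] is [lam i ^+ m.+1] times the diagonal
   entry of [B^T B]. *)
- move=> i; have -> : lam i + E i i = (B^T *m B) i i.
    by rewrite /E [X in _ + X]mxE [X in _ + (_ + X)]mxE !mxE eqxx mulr1n addrC subrK.
  rewrite HB trmx_mul tr_dmx mulmxA -(mulmxA _ B^T) mul_mx_diag mxE mul_diag_mx !mxE.
  by rewrite /lam -exprM mulnC exprM expr2; ring.
- move=> i; rewrite gram_diag_ge0 /=.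
  have := proj_diag_le1 R d P i PT PP; rewrite /P mxE mulrC ler_pdivrMr ?mul1r //.
  by rewrite ltr0n.
- rewrite -/(\tr (H^T *m H)) mxtrace_mulC HH mxtrace_scalar mulr_natr //.
- by apply: le_trans Edelta; exact: sqfrob_diag_le.
(* The projections [J] and [1 - J] are both positive semidefinite, which gives the two bounds on
   [q i]. *)
- move=> i; rewrite mulrC; apply/andP; split.
    have := gram_diag_ge0 K d (J *m H) i; rewrite trmx_mul JT mulmxA -(mulmxA H^T) JJ => h.
    by rewrite divr_ge0.
  rewrite ler_pM2r ?invr_gt0 ?ltr0n // -subr_ge0.
  have := gram_diag_ge0 K d ((1%:M - J) *m H) i.
  rewrite trmx_mul QT mulmxA -(mulmxA H^T) QQ mulmxBr mulmx1 mulmxBl.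
  by rewrite [X in 0 <= X]mxE [X in 0 <= _ + X]mxE.
rewrite -mulr_sumr -/(\tr (H^T *m J *m H)) -mulmxA mxtrace_mulC -mulmxA HH mul_mx_scalar.
by rewrite linearZ /= centering_trace // mulrA mulVf // mul1r.
Qed.

End Assembly.

Theorem theorem2 (R : realType) (K n d L : nat)
  (X : 'M[R]_(d, K * n)) (Ws : nat -> 'M[R]_d) (WL : 'M[R]_(K, d)) (eps : R) :
  d = (K * n)%N ->
  X^T *m X = 1%:M ->
  (2 * K < d)%N ->
  (2 <= L)%N ->
  0 < eps ->
  eps <= (n%:R) `^ (1 / (2 * L)%:R)
           / (Num.sqrt 30 * L%:R * ((d - K)%:R) `^ (1 / 4)) ->
  eps <= (n%:R / 2) `^ (1 / (4 * L)%:R) / ((d - K)%:R) `^ (1 / 4) ->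
  eps <= 1 / Num.sqrt (2 * (Num.sqrt K%:R + 1)) ->
  (* (i) global optimality *)
  WL *m prodW Ws L.-1 *m X = Ylab R K n ->
  (* (ii) balancedness *)
  (forall l, (1 <= l <= L - 2)%N -> (Ws l.+1)^T *m Ws l.+1 = Ws l *m (Ws l)^T) ->
  frob (WL^T *m WL - Ws L.-1 *m (Ws L.-1)^T) <= eps ^+ 2 * Num.sqrt (d - K)%:R ->
  (* (iii) unchanged spectrum *)
  (exists A : {set 'I_d}, #|A| = (d - 2 * K)%N /\
     forall l, (1 <= l <= L.-1)%N -> forall i, i \in A -> sigma (Ws l) i = eps) ->
  forall l, (l <= L - 2)%N ->
    Dsep X Ws l.+1 / Dsep X Ws l <= 2 * (Num.sqrt K%:R + 1) * eps ^+ 2.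
Proof.
move=> dE XX' Kd L2 e0 eps1 _ eps3 opt bal fr [A [cA sA]] l lL.
have K0 : (0 < K)%N by case: (K) dE Kd => // ->.
(* Here [d = n * K], so [2 * K < d] forces more than two samples per class. *)
have n2 : (2 < n)%N by move: Kd; rewrite dE mulnC ltn_pmul2l.
have [m LE] : exists m, L = m.+2 by exists (L - 2)%N; lia.
have dK : (0 < d - K)%N by lia.
have [s [s1 sn ds]] := eps_delta_bound R n (d - K) L eps (ltnW (ltnW n2)) dK L2 e0 eps1.
have a_half := eps_a_bound R K eps e0 eps3.
subst L d; rewrite subn2 /= in opt bal fr sA lL.
have XX := mulmx1C XX'.
have rhs0 : 2 * (Num.sqrt K%:R * eps ^+ 2) <= 2 * (Num.sqrt K%:R + 1) * eps ^+ 2.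
  by have := sqr_ge0 eps; lra.
apply: le_trans rhs0.
(* The spectral argument needs [K - 1 >= 1]; a single class is settled by the convention on division
   by 0. *)
have [K1|K1] := leqP 2 K; last first.
  have KE : K = 1%N by lia.
  subst K; rewrite Dsep_single_class ?(ltnW (ltnW n2)) // mul0r.
  by rewrite mulr_ge0 // mulr_ge0 ?sqrtr_ge0 ?sqr_ge0.
apply: (Dsep_ratio_le R K n (K * n) m X Ws WL eps s A) => //; first exact: ltnW.
by move=> i; apply: sA.
Qed.
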